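(* The functor $\mathsf{Prim}$ from the category of all rack bialgebras over $K$ to the category of all Leibniz algebras over $K$, associating to each rack bialgebra its Leibniz algebra of all primitive elements, has a left adjoint functor, namely $\mathsf{UR}$. In particular, for a given Leibniz algebra $(\mathfrak{h},[~,~])$ the rack bialgebra $\mathsf{UR}(\mathfrak{h})$ has the usual universal property: for every rack bialgebra $C$ and every morphism of Leibniz algebras $f:\mathfrak{h}\to\mathsf{Prim}(C)$ there is a unique morphism of rack bialgebras $\hat f:\mathsf{UR}(\mathfrak{h})\to C$ whose restriction to $\mathfrak{h}$ is $f$.
   Context: $K$ is an associative commutative unital ring containing $\mathbb{Q}$, $\otimes=\otimes_K$. A $C^3$-coalgebra is a $K$-module $C$ with coassociative comultiplication $\Delta$, counit $\epsilon$, and an element $\mathbf{1}$ with $\Delta(\mathbf{1})=\mathbf{1}\otimes\mathbf{1}$, $\epsilon(\mathbf{1})=1$; morphisms are $K$-linear maps respecting $\Delta,\epsilon,\mathbf{1}$. A rack bialgebra $(B,\Delta,\epsilon,\mathbf{1},\mu)$ is a $C^3$-coalgebra with a morphism of $C^3$-coalgebras $\mu:B\otimes B\to B$, written $\mu(a\otimes b)=a\triangleright b$, such that for all $a,b,c$: $\mathbf{1}\triangleright a=a$, $a\triangleright\mathbf{1}=\epsilon(a)\mathbf{1}$, $a\triangleright(b\triangleright c)=\sum_{(a)}(a^{(1)}\triangleright b)\triangleright(a^{(2)}\triangleright c)$. Morphisms of rack bialgebras are multiplicative morphisms of $C^3$-coalgebras. A (left) Leibniz algebra is a $K$-module with a bilinear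 bracket satisfying $[x,[y,z]]=[[x,y],z]+[y,[x,z]]$; morphisms are bracket-preserving $K$-linear maps. For a rack bialgebra $B$, $\mathsf{Prim}(B)=\{x:\Delta(x)=x\otimes\mathbf{1}+\mathbf{1}\otimes x\}$ is a Leibniz algebra with bracket $[x,y]=x\triangleright y$. For a Leibniz algebra $\mathfrak{h}$, $\mathsf{UR}(\mathfrak{h})=K\oplus\mathfrak{h}$ with $\mathbf{1}=1_K$ and, for $\lambda,\lambda'\in K$, $x,x'\in\mathfrak{h}$: $\Delta(\lambda\mathbf{1}+x)=\lambda\mathbf{1}\otimes\mathbf{1}+x\otimes\mathbf{1}+\mathbf{1}\otimes x$, $\epsilon(\lambda\mathbf{1}+x)=\lambda$, $\mu\big((\lambda\mathbf{1}+x)\otimes(\lambda'\mathbf{1}+x')\big)=\lambda\lambda'\mathbf{1}+\lambda x'+[x,x']$. For a morphism $f:\mathfrak{h}\to\mathfrak{h}'$ of Leibniz algebras, $\mathsf{UR}(f)(\lambda\mathbf{1}+x)=\lambda\mathbf{1}+f(x)$. *)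

(* Defs.v *)
From HB Require Import structures.
From mathcomp Require Import all_boot all_order all_algebra.
From mathcomp Require Import boolp.

Set Implicit Arguments.
Unset Strict Implicit.
Unset Printing Implicit Defensive.

Import GRing.Theory.
Local Open Scope ring_scope.
Local Open Scope quotient_scope.

Declare Scope rack_scope.
Delimit Scope rack_scope with rack.
Local Open Scope rack_scope.

(* A word [:: (u1, v1); ..; (un, vn)] stands for the sum of the u_i (x) v_i.
   The quotient of the free monoid of words by this congruence is U (x)_K V:
   K acts on the left factors, the opposite of u (x) v is (- u) (x) v, and
   tens_zero makes this a group. Its universal property is tliftE together with
   tlift_unique below. *)

Inductive tens_rel (K : comNzRingType) (U V : lmodType K) :
    seq (U * V) -> seq (U * V) -> Prop :=
  | tens_refl s : tens_rel s s
  | tens_sym s t : tens_rel s t -> tens_rel t s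
  | tens_trans s t r : tens_rel s t -> tens_rel t r -> tens_rel s r
  | tens_cat s s' t t' :
      tens_rel s s' -> tens_rel t t' -> tens_rel (s ++ t) (s' ++ t')
  | tens_catC s t : tens_rel (s ++ t) (t ++ s)
  | tens_addl u u' v : tens_rel [:: (u + u', v)] [:: (u, v); (u', v)]
  | tens_addr u v v' : tens_rel [:: (u, v + v')] [:: (u, v); (u, v')]
  | tens_zero v : tens_rel [:: (0, v)] [::]
  | tens_balance a u v : tens_rel [:: (a *: u, v)] [:: (u, a *: v)].

Section Tensor.
Variables (K : comNzRingType) (U V : lmodType K).
Implicit Types (s t : seq (U * V)) (u : U) (v : V) (a : K).

Definition tens_relb : rel (seq (U * V)) := fun s t => `[< tens_rel s t >].

Lemma tens_relb_refl : reflexive tens_relb.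
Proof. by move=> s; apply/asboolP; apply: tens_refl. Qed.

Lemma tens_relb_sym : symmetric tens_relb.
Proof. by move=> s t; apply/asboolP/asboolP; apply: tens_sym. Qed.

Lemma tens_relb_trans : transitive tens_relb.
Proof.
move=> t s r /asboolP st /asboolP tr.
by apply/asboolP; apply: tens_trans st tr.
Qed.

Canonical tens_equiv := EquivRel tens_relb
  tens_relb_refl tens_relb_sym tens_relb_trans.

Definition tensor : Type := {eq_quot tens_equiv}.
HB.instance Definition _ := Choice.on tensor.

Definition tens_pi s : tensor := \pi_({eq_quot tens_equiv}) s.
Definition tens_repr (x : tensor) : seq (U * V) :=
  repr (x : {eq_quot tens_equiv}).

Lemma tens_reprK x : tens_pi (tens_repr x) = x.
Proof. exact: (@reprK _ {eq_quot tens_equiv}). Qed.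

Lemma tens_piP s t : tens_pi s = tens_pi t <-> tens_rel s t.
Proof.
split; first by move/eqmodP/asboolP.
by move=> st; apply/eqmodP/asboolP.
Qed.

Lemma tens_repr_pi s : tens_rel (tens_repr (tens_pi s)) s.
Proof. by apply/tens_piP; rewrite tens_reprK. Qed.

Definition tens_scalew a s := [seq (a *: p.1, p.2) | p <- s].

Definition tens_add (x y : tensor) : tensor :=
  tens_pi (tens_repr x ++ tens_repr y).
Definition tens_scale a (x : tensor) : tensor :=
  tens_pi (tens_scalew a (tens_repr x)).
Definition tens_opp (x : tensor) : tensor := tens_scale (- 1) x.

Lemma tens_rel_scale a s t :
  tens_rel s t -> tens_rel (tens_scalew a s) (tens_scalew a t).
Proof.
elim=> {s t} /=.
- by move=> s; apply: tens_refl.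
- by move=> s t _; apply: tens_sym.
- by move=> s t r _ st _; apply: tens_trans.
- by move=> s s' t t' _ ss' _ tt'; rewrite /tens_scalew !map_cat; apply: tens_cat.
- by move=> s t; rewrite /tens_scalew !map_cat; apply: tens_catC.
- by move=> u u' v; rewrite scalerDr; apply: tens_addl.
- by move=> u v v'; apply: tens_addr.
- by move=> v; rewrite scaler0; apply: tens_zero.
- move=> b u v; rewrite scalerA mulrC -scalerA; exact: tens_balance.
Qed.

Lemma tens_pi_add s t : tens_add (tens_pi s) (tens_pi t) = tens_pi (s ++ t).
Proof. by apply/tens_piP; apply: tens_cat; apply: tens_repr_pi. Qed.

Lemma tens_pi_scale a s : tens_scale a (tens_pi s) = tens_pi (tens_scalew a s).
Proof. by apply/tens_piP; apply: tens_rel_scale; apply: tens_repr_pi. Qed.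

Lemma tens_piW (P : tensor -> Prop) : (forall s, P (tens_pi s)) -> forall x, P x.
Proof. by move=> Ppi x; rewrite -[x]tens_reprK. Qed.

Fact tens_addA : associative tens_add.
Proof.
elim/tens_piW=> s; elim/tens_piW=> t; elim/tens_piW=> r.
by rewrite !tens_pi_add catA.
Qed.

Fact tens_addC : commutative tens_add.
Proof.
elim/tens_piW=> s; elim/tens_piW=> t; rewrite !tens_pi_add.
by apply/tens_piP; apply: tens_catC.
Qed.

Fact tens_add0 : left_id (tens_pi [::]) tens_add.
Proof. by elim/tens_piW=> s; rewrite tens_pi_add. Qed.

Fact tens_scaleDr a x y :
  tens_scale a (tens_add x y) = tens_add (tens_scale a x) (tens_scale a y).
Proof.
elim/tens_piW: x => s; elim/tens_piW: y => t.
by rewrite tens_pi_add !tens_pi_scale tens_pi_add /tens_scalew map_cat.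
Qed.

Fact tens_scaleDl x a b :
  tens_scale (a + b) x = tens_add (tens_scale a x) (tens_scale b x).
Proof.
elim/tens_piW: x; elim=> [|[u v] s IHs].
  by rewrite !tens_pi_scale tens_pi_add.
have consE c : tens_scale c (tens_pi ((u, v) :: s)) =
    tens_add (tens_pi [:: (c *: u, v)]) (tens_scale c (tens_pi s)).
  by rewrite !tens_pi_scale tens_pi_add.
rewrite !consE IHs; have -> : tens_pi [:: ((a + b) *: u, v)] =
    tens_add (tens_pi [:: (a *: u, v)]) (tens_pi [:: (b *: u, v)]).
  by rewrite tens_pi_add scalerDl; apply/tens_piP; apply: tens_addl.
rewrite -!tens_addA; congr tens_add.
by rewrite !tens_addA; congr tens_add; rewrite tens_addC.
Qed.

Fact tens_scale1 : left_id 1 tens_scale.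
Proof.
elim/tens_piW=> s; rewrite tens_pi_scale /tens_scalew; congr tens_pi.
by rewrite -[RHS]map_id; apply: eq_map => -[u v] /=; rewrite scale1r.
Qed.

Fact tens_scaleA a b x :
  tens_scale a (tens_scale b x) = tens_scale (a * b) x.
Proof.
elim/tens_piW: x => s; rewrite !tens_pi_scale /tens_scalew -map_comp.
by congr tens_pi; apply: eq_map => -[u v] /=; rewrite scalerA.
Qed.

Fact tens_scale0 x : tens_scale 0 x = tens_pi [::].
Proof.
elim/tens_piW: x; elim=> [|[u v] s IHs]; first by rewrite tens_pi_scale.
move: IHs; rewrite !tens_pi_scale => /tens_piP IHs; apply/tens_piP.
rewrite /= -[[::]]/([::] ++ [::]) -cat1s scale0r.
by apply: tens_cat => //; apply: tens_zero.
Qed.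

Fact tens_addN : left_inverse (tens_pi [::]) tens_opp tens_add.
Proof.
move=> x; rewrite -{2}[x]tens_scale1 /tens_opp -tens_scaleDl.
by rewrite addNr tens_scale0.
Qed.

HB.instance Definition _ := GRing.isZmodule.Build tensor
  tens_addA tens_addC tens_add0 tens_addN.

HB.instance Definition _ := GRing.Zmodule_isLmodule.Build K tensor
  tens_scaleA tens_scale1 tens_scaleDr tens_scaleDl.

Definition tens u v : tensor := tens_pi [:: (u, v)].

Fact tens_is_bilinear : bilinear_for *:%R *:%R tens.
Proof.
have tensDl v u u' : tens (u + u') v = tens u v + tens u' v.
  by rewrite /tens [RHS]tens_pi_add; apply/tens_piP; apply: tens_addl.
have tensDr u v v' : tens u (v + v') = tens u v + tens u v'.
  by rewrite /tens [RHS]tens_pi_add; apply/tens_piP; apply: tens_addr.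
have tensZl a u v : tens (a *: u) v = a *: tens u v.
  by rewrite /tens [RHS]tens_pi_scale.
have tensZr a u v : tens u (a *: v) = a *: tens u v.
  by rewrite -tensZl; apply/esym/tens_piP; apply: tens_balance.
by split=> [v a u u'|u a v v']; rewrite ?tensDl ?tensDr ?tensZl ?tensZr.
Qed.

HB.instance Definition _ := bilinear_isBilinear.Build K U V tensor
  _ _ tens tens_is_bilinear.

Lemma tens_piE s : tens_pi s = \sum_(p <- s) tens p.1 p.2.
Proof.
elim: s => [|[u v] s IHs]; first by rewrite big_nil.
by rewrite big_cons -IHs; rewrite [RHS]tens_pi_add.
Qed.

Lemma tens_ind (P : tensor -> Prop) :
  (forall u v, P (tens u v)) -> P 0 ->
  (forall x y, P x -> P y -> P (x + y)) -> forall x, P x.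
Proof.
move=> Pt P0 PD; elim/tens_piW => s; rewrite tens_piE.
by elim/big_ind: _ => // -[u v] _; apply: Pt.
Qed.

End Tensor.

Notation "U ⊗ V" := (tensor U V)
  (at level 40, left associativity) : type_scope.
Notation "U ⊗ V" := (tensor U V)
  (at level 40, left associativity) : rack_scope.
Notation "u ⊗ₜ v" := (tens u v)
  (at level 40, left associativity) : rack_scope.

Section TensorMaps.
Variable K : comNzRingType.
Implicit Types U V W : lmodType K.

Fact tens_is_linear U V (u : U) : linear (@tens K U V u).
Proof. by case: (@tens_is_bilinear K U V) => _; apply. Qed.
HB.instance Definition _ U V (u : U) :=
  GRing.isLinear.Build K V (U ⊗ V) *:%R (@tens K U V u) (tens_is_linear u).

Definition tensr U V (v : V) (u : U) : U ⊗ V := u ⊗ₜ v.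
Fact tensr_is_linear U V (v : V) : linear (@tensr U V v).
Proof. by case: (@tens_is_bilinear K U V) => + _; apply. Qed.
HB.instance Definition _ U V (v : V) :=
  GRing.isLinear.Build K U (U ⊗ V) *:%R (@tensr U V v) (tensr_is_linear v).

Lemma tensDl U V (u u' : U) (v : V) : (u + u') ⊗ₜ v = u ⊗ₜ v + u' ⊗ₜ v.
Proof. exact: (linearD (tensr v)). Qed.
Lemma tensDr U V (u : U) (v v' : V) : u ⊗ₜ (v + v') = u ⊗ₜ v + u ⊗ₜ v'.
Proof. exact: linearD. Qed.
Lemma tensZl U V a (u : U) (v : V) : (a *: u) ⊗ₜ v = a *: (u ⊗ₜ v).
Proof. exact: (linearZ_LR (tensr v)). Qed.
Lemma tensZr U V a (u : U) (v : V) : u ⊗ₜ (a *: v) = a *: (u ⊗ₜ v).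
Proof. exact: linearZ_LR. Qed.
Lemma tens0l U V (v : V) : (0 : U) ⊗ₜ v = 0.
Proof. exact: (linear0 (tensr v)). Qed.
Lemma tens0r U V (u : U) : u ⊗ₜ (0 : V) = 0.
Proof. exact: linear0. Qed.

(* This does not depend on the chosen representative of x, by tlift_pi. *)
Definition tlift U V W (f : {bilinear U -> V -> W}) (x : U ⊗ V) : W :=
  \sum_(p <- tens_repr x) f p.1 p.2.

Lemma tlift_pi U V W (f : {bilinear U -> V -> W}) (s : seq (U * V)) :
  tlift f (tens_pi s) = \sum_(p <- s) f p.1 p.2.
Proof.
have := tens_repr_pi s; rewrite /tlift; move: (tens_repr _) => t.
elim=> {s t} //=.
- by move=> s t r _ -> _ ->.
- by move=> s s' t t' _ ss' _ tt'; rewrite !big_cat /= ss' tt'.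
- by move=> s t; rewrite !big_cat /= addrC.
- by move=> u u' v; rewrite !big_cons !big_nil /= !addr0 linearDl.
- by move=> u v v'; rewrite !big_cons !big_nil /= !addr0 linearDr.
- by move=> v; rewrite !big_cons !big_nil /= addr0 linear0l.
- by move=> a u v; rewrite !big_cons !big_nil /= !addr0 linearZl_LR linearZr_LR.
Qed.

Lemma tliftE U V W (f : {bilinear U -> V -> W}) u v : tlift f (u ⊗ₜ v) = f u v.
Proof. by rewrite [LHS]tlift_pi big_seq1. Qed.

Fact tlift_is_linear U V W (f : {bilinear U -> V -> W}) : linear (tlift f).
Proof.
move=> a; elim/tens_piW=> s; elim/tens_piW=> t.
have -> : a *: tens_pi s + tens_pi t = tens_pi (tens_scalew a s ++ t).
  by rewrite -tens_pi_add -tens_pi_scale.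
rewrite !tlift_pi big_cat /= big_map scaler_sumr; congr (_ + _).
by apply: eq_bigr => p _; rewrite linearZl_LR.
Qed.
HB.instance Definition _ U V W (f : {bilinear U -> V -> W}) :=
  GRing.isLinear.Build K (U ⊗ V) W *:%R (tlift f) (tlift_is_linear f).

Lemma tens_ext U V W (f g : {linear U ⊗ V -> W}) :
  (forall u v, f (u ⊗ₜ v) = g (u ⊗ₜ v)) -> f =1 g.
Proof.
move=> fg; elim/tens_ind => [//||x y fx fy]; first by rewrite !linear0.
by rewrite !linearD fx fy.
Qed.

Lemma tlift_unique U V W (f : {bilinear U -> V -> W}) (g : {linear U ⊗ V -> W}) :
  (forall u v, g (u ⊗ₜ v) = f u v) -> g =1 tlift f.
Proof. by move=> gf; apply: tens_ext => u v; rewrite gf /= tliftE. Qed.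

Section Map.
Variables (U V U' V' : lmodType K) (f : {linear U -> U'}) (g : {linear V -> V'}).

Definition tmap_form (u : U) (v : V) : U' ⊗ V' := f u ⊗ₜ g v.
Fact tmap_form_is_bilinear : bilinear_for *:%R *:%R tmap_form.
Proof.
by split=> [v a u u'|u a v v']; rewrite /tmap_form linearP (tensDl, tensDr)
  (tensZl, tensZr).
Qed.
HB.instance Definition _ := bilinear_isBilinear.Build K U V (U' ⊗ V')
  _ _ tmap_form tmap_form_is_bilinear.

Definition tmap : U ⊗ V -> U' ⊗ V' := tlift tmap_form.
HB.instance Definition _ := GRing.Linear.on tmap.

Lemma tmapE u v : tmap (u ⊗ₜ v) = f u ⊗ₜ g v.
Proof. exact: tliftE. Qed.

Definition tscal_form (p : {linear U -> K^o}) (q : {linear V -> K^o})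
  (u : U) (v : V) : K^o := p u * q v.
Fact tscal_form_is_bilinear p q : bilinear_for *:%R *:%R (tscal_form p q).
Proof.
split=> [v a u u'|u a v v']; rewrite /tscal_form linearP.
  by rewrite mulrDl -scalerAl.
by rewrite mulrDr -scalerAr.
Qed.
HB.instance Definition _ p q := bilinear_isBilinear.Build K U V K^o
  _ _ (tscal_form p q) (tscal_form_is_bilinear p q).

(* p (x) q followed by the identification of K (x) K with K. *)
Definition tscal p q : U ⊗ V -> K^o := tlift (tscal_form p q).
HB.instance Definition _ p q := GRing.Linear.on (tscal p q).

Lemma tscalE p q u v : tscal p q (u ⊗ₜ v) = p u * q v.
Proof. exact: tliftE. Qed.

End Map.

Section Assoc.
Variables U V W : lmodType K.

Definition tassoc_form (x : U ⊗ V) (w : W) : U ⊗ (V ⊗ W) :=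
  tmap idfun (tensr w) x.
Fact tassoc_form_is_bilinear : bilinear_for *:%R *:%R tassoc_form.
Proof.
split=> [w a x x'|x a w w']; rewrite /tassoc_form; first by rewrite linearP.
elim/tens_ind: x => [u v||x y]; first by rewrite !tmapE /= /tensr linearP linearP.
  by rewrite /= !linear0 addr0.
by move=> IHx IHy; rewrite !(linearD (tmap _ _)) /= IHx IHy addrACA scalerDr.
Qed.
HB.instance Definition _ := bilinear_isBilinear.Build K (U ⊗ V) W (U ⊗ (V ⊗ W))
  _ _ tassoc_form tassoc_form_is_bilinear.

Definition tassoc : (U ⊗ V) ⊗ W -> U ⊗ (V ⊗ W) := tlift tassoc_form.
HB.instance Definition _ := GRing.Linear.on tassoc.

Lemma tassocE u v w : tassoc ((u ⊗ₜ v) ⊗ₜ w) = u ⊗ₜ (v ⊗ₜ w).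
Proof. by rewrite /tassoc tliftE /= /tassoc_form tmapE. Qed.

End Assoc.

Section Middle.
Variables A B C D : lmodType K.

Definition tmid_aux (y : C ⊗ D) (a : A) (b : B) : (A ⊗ C) ⊗ (B ⊗ D) :=
  tmap (tens a) (tens b) y.
Fact tmid_aux_is_bilinear y : bilinear_for *:%R *:%R (tmid_aux y).
Proof.
split=> [b k a a'|a k b b']; rewrite /tmid_aux.
  elim/tens_ind: y => [c d||x y]; first by rewrite !tmapE /= tensDl tensZl tensDl tensZl.
    by rewrite /= !linear0 addr0.
  by move=> IHx IHy; rewrite !(linearD (tmap _ _)) /= IHx IHy addrACA scalerDr.
elim/tens_ind: y => [c d||x y].
    by rewrite !tmapE /= tensDl tensZl tensDr tensZr.
  by rewrite /= !linear0 addr0.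
by move=> IHx IHy; rewrite !(linearD (tmap _ _)) /= IHx IHy addrACA scalerDr.
Qed.
HB.instance Definition _ y := bilinear_isBilinear.Build K A B
  ((A ⊗ C) ⊗ (B ⊗ D)) _ _ (tmid_aux y) (tmid_aux_is_bilinear y).

Definition tmid_form (x : A ⊗ B) (y : C ⊗ D) : (A ⊗ C) ⊗ (B ⊗ D) :=
  tlift (tmid_aux y) x.
Fact tmid_form_is_bilinear : bilinear_for *:%R *:%R tmid_form.
Proof.
split=> [y k x x'|x k y y']; rewrite /tmid_form; first by rewrite linearP.
elim/tens_ind: x => [a b||x x']; first by rewrite !tliftE /= /tmid_aux linearP.
  by rewrite /= !linear0 addr0.
by move=> IHx IHy; rewrite !(linearD (tlift _)) /= IHx IHy addrACA scalerDr.
Qed.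
HB.instance Definition _ := bilinear_isBilinear.Build K (A ⊗ B) (C ⊗ D)
  ((A ⊗ C) ⊗ (B ⊗ D)) _ _ tmid_form tmid_form_is_bilinear.

Definition tmid : (A ⊗ B) ⊗ (C ⊗ D) -> (A ⊗ C) ⊗ (B ⊗ D) := tlift tmid_form.
HB.instance Definition _ := GRing.Linear.on tmid.

Lemma tmidE a b c d : tmid ((a ⊗ₜ b) ⊗ₜ (c ⊗ₜ d)) = (a ⊗ₜ c) ⊗ₜ (b ⊗ₜ d).
Proof.
by rewrite /tmid tliftE /= /tmid_form tliftE /= /tmid_aux tmapE.
Qed.

End Middle.

End TensorMaps.

Arguments tassoc {K U V W}.
Arguments tmid {K A B C D}.
Arguments tscal {K U V}.

(* The counit axioms are stated in K (x) C and C (x) K rather than through the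
   identification of these modules with C. *)
HB.mixin Record isC3Coalgebra (K : comNzRingType) C of GRing.Lmodule K C := {
  comul : {linear C -> C ⊗ C};
  counit : {linear C -> K^o};
  coone : C;
  comulA : forall c,
    tassoc (tmap comul idfun (comul c)) = tmap idfun comul (comul c);
  counitl : forall c, tmap counit idfun (comul c) = (1 : K^o) ⊗ₜ c;
  counitr : forall c, tmap idfun counit (comul c) = c ⊗ₜ (1 : K^o);
  comul_coone : comul coone = coone ⊗ₜ coone;
  counit_coone : counit coone = 1
}.

#[short(type="c3CoalgType")]
HB.structure Definition C3Coalgebra (K : comNzRingType) :=
  { C of GRing.Lmodule K C & isC3Coalgebra K C }.

Arguments coone {K s}.

Record c3_morphism (K : comNzRingType) (C D : c3CoalgType K)
    (f : {linear C -> D}) : Prop := C3Morphism {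
  c3m_comul : forall c, comul (f c) = tmap f f (comul c);
  c3m_counit : forall c, counit (f c) = counit c;
  c3m_coone : f coone = coone
}.

Section TensorCoalgebra.
Variables (K : comNzRingType) (C D : c3CoalgType K).

Definition tens_comul : C ⊗ D -> (C ⊗ D) ⊗ (C ⊗ D) :=
  tmid \o tmap comul comul.
HB.instance Definition _ := GRing.Linear.on tens_comul.
Definition tens_counit : C ⊗ D -> K^o := tscal counit counit.
HB.instance Definition _ := GRing.Linear.on tens_counit.

Definition tens_coone : C ⊗ D := coone ⊗ₜ coone.

Lemma tens_comulE c d : tens_comul (c ⊗ₜ d) = tmid (comul c ⊗ₜ comul d).
Proof. by rewrite /tens_comul /= tmapE. Qed.

Lemma tens_counitE c d : tens_counit (c ⊗ₜ d) = counit c * counit d.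
Proof. exact: tscalE. Qed.

End TensorCoalgebra.

Arguments tens_comul {K C D}.
Arguments tens_counit {K C D}.
Arguments tens_coone {K C D}.

Section TensorCoalgebraLaws.
Variables (K : comNzRingType).

Lemma tens_ext4 (A B C D W : lmodType K)
    (F G : {linear (A ⊗ B) ⊗ (C ⊗ D) -> W}) :
  (forall a b c d, F ((a ⊗ₜ b) ⊗ₜ (c ⊗ₜ d)) = G ((a ⊗ₜ b) ⊗ₜ (c ⊗ₜ d))) ->
  F =1 G.
Proof.
move=> FG; apply: tens_ext => x y.
elim/tens_ind: x => [a b||x x' IHx IHx']; first 1 last.
- by rewrite !tens0l !linear0.
- by rewrite !tensDl !linearD IHx IHx'.
elim/tens_ind: y => [//||y y' IHy IHy'].
- by rewrite !tens0r !linear0.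
- by rewrite !tensDr !linearD IHy IHy'.
Qed.

Variables C D : c3CoalgType K.

Fact tens_comulA (x : C ⊗ D) :
  tassoc (tmap tens_comul idfun (tens_comul x)) =
  tmap idfun tens_comul (tens_comul x).
Proof.
pose Phi : {linear (C ⊗ (C ⊗ C)) ⊗ (D ⊗ (D ⊗ D)) -> (C ⊗ D) ⊗ ((C ⊗ D) ⊗ (C ⊗ D))} :=
  tmap idfun tmid \o tmid.
have inner c d : tassoc \o tensr (c ⊗ₜ d) \o tmid =1
    Phi \o tmap (tassoc \o tensr c) (tassoc \o tensr d).
  apply: tens_ext4 => a b e f.
  by rewrite /Phi /= !tmidE /tensr tmapE /= !tassocE tmidE tmapE /= tmidE.
have left : tassoc \o tmap tens_comul idfun \o tmid =1
    Phi \o tmap (tassoc \o tmap comul idfun)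
                (tassoc \o tmap comul idfun).
  apply: tens_ext4 => a b c d.
  rewrite /= tmidE !tmapE /= !tmapE /= tens_comulE.
  by have /= := inner b d (comul a ⊗ₜ comul c); rewrite tmapE.
have right : tmap idfun tens_comul \o tmid =1
    Phi \o tmap (tmap idfun comul) (tmap idfun comul).
  apply: tens_ext4 => a b c d.
  by rewrite /Phi /= tmidE !tmapE /= !tmapE /= tmidE tens_comulE tmapE.
pose F : {linear C ⊗ D -> _} := tassoc \o tmap tens_comul idfun \o tens_comul.
pose G : {linear C ⊗ D -> _} := tmap idfun tens_comul \o tens_comul.
apply: (tens_ext (f := F) (g := G)) => c d; rewrite /F /G /= {F G}.
rewrite tens_comulE.
have /= -> := left (comul c ⊗ₜ comul d).
have /= -> := right (comul c ⊗ₜ comul d).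
by rewrite !tmapE /= !comulA.
Qed.

Fact tens_counitl (x : C ⊗ D) :
  tmap tens_counit idfun (tens_comul x) = (1 : K^o) ⊗ₜ x.
Proof.
pose Psi : {linear (K^o ⊗ C) ⊗ (K^o ⊗ D) -> K^o ⊗ (C ⊗ D)} :=
  tmap (tscal idfun idfun) idfun \o tmid.
pose L : {linear (C ⊗ C) ⊗ (D ⊗ D) -> _} := tmap tens_counit idfun \o tmid.
pose R : {linear (C ⊗ C) ⊗ (D ⊗ D) -> _} :=
  Psi \o tmap (tmap counit idfun) (tmap counit idfun).
have left : L =1 R.
  apply: tens_ext4 => a b c d; rewrite /L /R.
  by rewrite /Psi /= tmidE !tmapE /= !tmapE tmidE tmapE /= tscalE tens_counitE.
pose F : {linear C ⊗ D -> _} := tmap tens_counit idfun \o tens_comul.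
pose G : {linear C ⊗ D -> _} := tens (1 : K^o).
apply: (tens_ext (f := F) (g := G)) => c d; rewrite /F /G /= {F G}.
rewrite tens_comulE; have /= -> := left (comul c ⊗ₜ comul d).
by rewrite /R /= tmapE /= !counitl /Psi /= tmidE tmapE /= tscalE /= mulr1.
Qed.

Fact tens_counitr (x : C ⊗ D) :
  tmap idfun tens_counit (tens_comul x) = x ⊗ₜ (1 : K^o).
Proof.
pose Psi : {linear (C ⊗ K^o) ⊗ (D ⊗ K^o) -> (C ⊗ D) ⊗ K^o} :=
  tmap idfun (tscal idfun idfun) \o tmid.
pose L : {linear (C ⊗ C) ⊗ (D ⊗ D) -> _} := tmap idfun tens_counit \o tmid.
pose R : {linear (C ⊗ C) ⊗ (D ⊗ D) -> _} :=
  Psi \o tmap (tmap idfun counit) (tmap idfun counit).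
have right : L =1 R.
  apply: tens_ext4 => a b c d; rewrite /L /R.
  by rewrite /Psi /= tmidE !tmapE /= !tmapE tmidE tmapE /= tscalE tens_counitE.
pose F : {linear C ⊗ D -> _} := tmap idfun tens_counit \o tens_comul.
pose G : {linear C ⊗ D -> _} := tensr (1 : K^o).
apply: (tens_ext (f := F) (g := G)) => c d; rewrite /F /G /= {F G}.
rewrite tens_comulE; have /= -> := right (comul c ⊗ₜ comul d).
by rewrite /R /= tmapE /= !counitr /Psi /= tmidE tmapE /= tscalE /= mulr1.
Qed.

Fact tens_comul_coone :
  tens_comul (tens_coone : C ⊗ D) = tens_coone ⊗ₜ tens_coone.
Proof. by rewrite tens_comulE !comul_coone tmidE. Qed.

Fact tens_counit_coone : tens_counit (tens_coone : C ⊗ D) = 1.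
Proof. by rewrite tens_counitE !counit_coone mulr1. Qed.

HB.instance Definition _ := isC3Coalgebra.Build K (C ⊗ D)
  tens_comulA tens_counitl tens_counitr tens_comul_coone tens_counit_coone.

End TensorCoalgebraLaws.

HB.mixin Record isRackBialgebra (K : comNzRingType) B of C3Coalgebra K B := {
  rack_mul : {linear B ⊗ B -> B};
  rack_mul_morphism : c3_morphism rack_mul;
  coone_rack : forall a : B, rack_mul (coone ⊗ₜ a) = a;
  rack_coone : forall a : B, rack_mul (a ⊗ₜ coone) = (counit a : K) *: coone;
  (* The right-hand side is the Sweedler sum of (a1 |> b) |> (a2 |> c). *)
  rack_selfdistr : forall a b c : B,
    rack_mul (a ⊗ₜ rack_mul (b ⊗ₜ c)) =
    rack_mul (tmap (rack_mul \o tensr b) (rack_mul \o tensr c) (comul a))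
}.

#[short(type="rackBialgType")]
HB.structure Definition RackBialgebra (K : comNzRingType) :=
  { B of C3Coalgebra K B & isRackBialgebra K B }.

Definition rack (K : comNzRingType) (B : rackBialgType K) (a b : B) : B :=
  rack_mul (a ⊗ₜ b).

Notation "a ▷ b" := (rack a b) (at level 40, left associativity) : rack_scope.

HB.mixin Record isLeibniz (K : comNzRingType) h of GRing.Lmodule K h := {
  lbracket : {bilinear h -> h -> h};
  lbracketP : forall x y z : h,
    lbracket x (lbracket y z) =
    lbracket (lbracket x y) z + lbracket y (lbracket x z)
}.

#[short(type="leibnizType")]
HB.structure Definition Leibniz (K : comNzRingType) :=
  { h of GRing.Lmodule K h & isLeibniz K h }.

Record rack_hom (K : comNzRingType) (B C : rackBialgType K) := RackHom {
  rack_hom_fun :> {linear B -> C};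
  rack_hom_c3 : c3_morphism rack_hom_fun;
  rack_homM : forall a b, rack_hom_fun (a ▷ b) = rack_hom_fun a ▷ rack_hom_fun b
}.

Record leibniz_hom (K : comNzRingType) (g h : leibnizType K) := LeibnizHom {
  leibniz_hom_fun :> {linear g -> h};
  leibniz_homM : forall x y, leibniz_hom_fun (lbracket x y) =
    lbracket (leibniz_hom_fun x) (leibniz_hom_fun y)
}.

Section Homs.
Variable K : comNzRingType.

Lemma linear_eqP (U V : lmodType K) (f g : {linear U -> V}) : f =1 g -> f = g.
Proof.
case: f => f [[fD] [fZ]]; case: g => g [[gD] [gZ]] /= /funext fg.
rewrite {}fg in fD fZ *.
by rewrite (Prop_irrelevance fD gD) (Prop_irrelevance fZ gZ).
Qed.

Lemma rack_hom_eqP (B C : rackBialgType K) (f g : rack_hom B C) :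
  f =1 g -> f = g.
Proof.
case: f => f fc fM; case: g => g gc gM /= /linear_eqP fg.
rewrite {}fg in fc fM *.
by rewrite (Prop_irrelevance fc gc) (Prop_irrelevance fM gM).
Qed.

Lemma leibniz_hom_eqP (g h : leibnizType K) (e f : leibniz_hom g h) :
  e =1 f -> e = f.
Proof.
case: e => e eM; case: f => f fM /= /linear_eqP ef.
by rewrite {}ef in eM *; rewrite (Prop_irrelevance eM fM).
Qed.

Lemma tmap_id (U V : lmodType K) (x : U ⊗ V) : tmap idfun idfun x = x.
Proof.
apply: (tens_ext (f := tmap idfun idfun) (g := idfun)) => u v.
by rewrite /= tmapE.
Qed.

Lemma tmap_comp (U V W U' V' W' : lmodType K)
    (f : {linear V -> W}) (f' : {linear V' -> W'})
    (g : {linear U -> V}) (g' : {linear U' -> V'}) (x : U ⊗ U') :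
  tmap (f \o g) (f' \o g') x = tmap f f' (tmap g g' x).
Proof.
apply: (tens_ext (f := tmap (f \o g) (f' \o g'))
                 (g := tmap f f' \o tmap g g')) => u v.
by rewrite /= !tmapE.
Qed.

Fact rack_id_c3 (B : c3CoalgType K) : c3_morphism (@idfun B).
Proof. by split=> //= c; rewrite tmap_id. Qed.

Definition rack_id (B : rackBialgType K) : rack_hom B B :=
  RackHom (@rack_id_c3 B) (fun _ _ => erefl).

Fact rack_comp_c3 (B C D : c3CoalgType K) (f : {linear C -> D})
    (g : {linear B -> C}) :
  c3_morphism f -> c3_morphism g -> c3_morphism (f \o g).
Proof.
move=> [fD fe f1] [gD ge g1]; split=> [b|b|] /=.
- by rewrite fD gD tmap_comp.
- by rewrite fe ge.
- by rewrite g1 f1.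
Qed.

Fact rack_compM (B C D : rackBialgType K) (f : rack_hom C D) (g : rack_hom B C)
  (a b : B) : (f \o g) (a ▷ b) = (f \o g) a ▷ (f \o g) b.
Proof. by rewrite /= !rack_homM. Qed.

Definition rack_comp (B C D : rackBialgType K) (f : rack_hom C D)
    (g : rack_hom B C) : rack_hom B D :=
  RackHom (rack_comp_c3 (rack_hom_c3 f) (rack_hom_c3 g)) (rack_compM f g).

Definition leibniz_id (h : leibnizType K) : leibniz_hom h h :=
  @LeibnizHom K h h idfun (fun _ _ => erefl).

Fact leibniz_compM (e g h : leibnizType K) (f : leibniz_hom g h)
    (f' : leibniz_hom e g) (x y : e) :
  (f \o f') (lbracket x y) = lbracket ((f \o f') x) ((f \o f') y).
Proof. by rewrite /= !leibniz_homM. Qed.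

Definition leibniz_comp (e g h : leibnizType K) (f : leibniz_hom g h)
    (f' : leibniz_hom e g) : leibniz_hom e h := LeibnizHom (leibniz_compM f f').

End Homs.

Lemma tmid_prim (K : comNzRingType) (U V : lmodType K) (u x : U) (v y : V) :
  tmid ((x ⊗ₜ u + u ⊗ₜ x) ⊗ₜ (y ⊗ₜ v + v ⊗ₜ y)) =
  (x ⊗ₜ y) ⊗ₜ (u ⊗ₜ v) + (u ⊗ₜ y) ⊗ₜ (x ⊗ₜ v)
    + ((x ⊗ₜ v) ⊗ₜ (u ⊗ₜ y) + (u ⊗ₜ v) ⊗ₜ (x ⊗ₜ y)).
Proof. by rewrite tensDr !tensDl !(linearD tmid) /= !tmidE. Qed.

Section Prim.
Variables (K : comNzRingType) (B : rackBialgType K).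

Definition prim_pred : {pred B} :=
  fun x => comul x == x ⊗ₜ coone + coone ⊗ₜ x.

Fact prim_submod_closed : submod_closed prim_pred.
Proof.
split=> [|a x y /eqP px /eqP py]; rewrite /prim_pred unfold_in.
  by rewrite linear0 tens0l tens0r addr0.
rewrite linearP /= px py tensDl tensDr tensZl tensZr scalerDr.
by rewrite addrACA.
Qed.
HB.instance Definition _ :=
  GRing.isSubmodClosed.Build K B prim_pred prim_submod_closed.

Record prim := Prim { prim_val : B; prim_valP : prim_val \in prim_pred }.
HB.instance Definition _ := [isSub for prim_val].
HB.instance Definition _ := [Choice of prim by <:].
HB.instance Definition _ := [SubChoice_isSubLmodule of prim by <:].

Lemma prim_comul (x : prim) :
  comul (\val x) = \val x ⊗ₜ coone + coone ⊗ₜ \val x.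
Proof. exact/eqP/(valP x). Qed.

Lemma prim_counit (x : prim) : counit (\val x) = 0.
Proof.
have /(congr1 (tscal idfun counit)) := counitl (\val x).
rewrite prim_comul [in LHS]linearD /= !tmapE /= linearD /= !tscalE /=.
rewrite !counit_coone !mulr1 mul1r => e.
by apply: (addIr (counit (\val x))); rewrite add0r.
Qed.

Fact prim_rack_subproof (x y : prim) : \val x ▷ \val y \in prim_pred.
Proof.
apply/eqP; rewrite /rack; case: (@rack_mul_morphism K B) => -> _ _.
rewrite [comul _]tens_comulE !prim_comul tmid_prim.
rewrite !(linearD (tmap _ _)) /= !tmapE !coone_rack !rack_coone.
by rewrite !prim_counit !scale0r tens0l tens0r addr0 add0r.
Qed.

Definition prim_bracket (x y : prim) : prim := Prim (prim_rack_subproof x y).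

Fact prim_bracket_is_bilinear : bilinear_for *:%R *:%R prim_bracket.
Proof.
split=> [y a x x'|x a y y']; apply: val_inj; rewrite /= /rack.
  by rewrite tensDl tensZl linearP.
by rewrite tensDr tensZr linearP.
Qed.
HB.instance Definition _ := bilinear_isBilinear.Build K prim prim prim
  _ _ prim_bracket prim_bracket_is_bilinear.

Fact prim_bracketP (x y z : prim) :
  prim_bracket x (prim_bracket y z) =
  prim_bracket (prim_bracket x y) z + prim_bracket y (prim_bracket x z).
Proof.
apply: val_inj; rewrite /= /rack rack_selfdistr prim_comul.
by rewrite !linearD /= !tmapE /= /tensr !coone_rack.
Qed.

HB.instance Definition _ := isLeibniz.Build K prim prim_bracketP.

End Prim.

Arguments prim_val {K B}.

Section PrimHom.
Variables (K : comNzRingType) (B C : rackBialgType K) (f : rack_hom B C).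

Fact prim_hom_subproof (x : prim B) : f (prim_val x) \in @prim_pred K C.
Proof.
apply/eqP; case: (rack_hom_c3 f) => -> _ f1.
by rewrite (prim_comul x) linearD /= !tmapE f1.
Qed.

Definition prim_fun (x : prim B) : prim C := Prim (prim_hom_subproof x).

Fact prim_fun_is_linear : linear prim_fun.
Proof. by move=> a x y; apply: val_inj; rewrite /= linearP. Qed.
HB.instance Definition _ :=
  GRing.isLinear.Build K (prim B) (prim C) *:%R prim_fun prim_fun_is_linear.

Fact prim_funM (x y : prim B) :
  prim_fun (lbracket x y) = lbracket (prim_fun x) (prim_fun y).
Proof. by apply: val_inj; rewrite /= rack_homM. Qed.

Definition prim_hom : leibniz_hom (prim B) (prim C) := LeibnizHom prim_funM.

End PrimHom.

Section UR.
Variables (K : comNzRingType) (h : leibnizType K).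

(* The pair (l, x) is l 1 + x. *)
Definition UR : Type := (K^o * h)%type.
HB.instance Definition _ := GRing.Lmodule.copy UR (K^o * h)%type.

Definition UR_one : UR := ((1 : K^o), (0 : h)).
Definition UR_inj (x : h) : UR := ((0 : K^o), x).

Fact UR_inj_is_linear : linear UR_inj.
Proof.
by move=> a x y; rewrite /UR_inj -[RHS]/(_, _) /= scaler0 addr0.
Qed.
HB.instance Definition _ :=
  GRing.isLinear.Build K h UR *:%R UR_inj UR_inj_is_linear.

Definition UR_comul (p : UR) : UR ⊗ UR :=
  (p.1 : K) *: (UR_one ⊗ₜ UR_one)
    + UR_inj p.2 ⊗ₜ UR_one + UR_one ⊗ₜ UR_inj p.2.

Definition UR_counit (p : UR) : K^o := p.1.

Definition UR_mul_form (p q : UR) : UR :=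
  ((p.1 * q.1 : K^o), ((p.1 : K) *: q.2 + lbracket p.2 q.2)).

Fact UR_comul_is_linear : linear UR_comul.
Proof.
move=> a p q; rewrite /UR_comul /= scalerDl -scalerA.
have -> : UR_inj (a *: p.2 + q.2) = a *: UR_inj p.2 + UR_inj q.2.
  exact: linearP.
rewrite tensDl tensZl tensDr tensZr !scalerDr.
by rewrite [X in X + _ = _]addrACA [LHS]addrACA.
Qed.
HB.instance Definition _ :=
  GRing.isLinear.Build K UR (UR ⊗ UR) *:%R UR_comul UR_comul_is_linear.

Fact UR_counit_is_linear : linear UR_counit.
Proof. by []. Qed.
HB.instance Definition _ :=
  GRing.isLinear.Build K UR K^o *:%R UR_counit UR_counit_is_linear.

Fact UR_mul_form_is_bilinear : bilinear_for *:%R *:%R UR_mul_form.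
Proof.
split=> [q a p p'|p a q q']; rewrite /UR_mul_form -[RHS]/(_, _) /=.
  congr pair; first by rewrite mulrDl -scalerAl.
  rewrite linearDl linearZl_LR scalerDl scalerDr scalerA.
  by rewrite addrACA.
congr pair; first by rewrite mulrDr -scalerAr.
rewrite linearDr linearZr_LR /= !scalerDr !scalerA [_ * a]mulrC.
by rewrite addrACA.
Qed.
HB.instance Definition _ := bilinear_isBilinear.Build K UR UR UR
  _ _ UR_mul_form UR_mul_form_is_bilinear.

Definition UR_mul : UR ⊗ UR -> UR := tlift UR_mul_form.
HB.instance Definition _ := GRing.Linear.on UR_mul.

Lemma UR_mulE p q : UR_mul (p ⊗ₜ q) = UR_mul_form p q.
Proof. exact: tliftE. Qed.

Lemma UR_decomp (p : UR) : p = (p.1 : K) *: UR_one + UR_inj p.2.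
Proof.
case: p => l x; rewrite -[RHS]/(_, _) /= scaler0 add0r addr0.
by congr pair; rewrite -[RHS]/(l * 1) mulr1.
Qed.

Lemma UR_ext (W : lmodType K) (F G : {linear UR -> W}) :
  F UR_one = G UR_one -> (forall x, F (UR_inj x) = G (UR_inj x)) -> F =1 G.
Proof.
by move=> F1 Fi p; rewrite [p]UR_decomp !linearD !linearZ_LR /= F1 Fi.
Qed.

Lemma UR_ext2 (W : lmodType K) (F G : {linear UR ⊗ UR -> W}) :
    F (UR_one ⊗ₜ UR_one) = G (UR_one ⊗ₜ UR_one) ->
    (forall y, F (UR_one ⊗ₜ UR_inj y) = G (UR_one ⊗ₜ UR_inj y)) ->
    (forall x, F (UR_inj x ⊗ₜ UR_one) = G (UR_inj x ⊗ₜ UR_one)) ->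
    (forall x y, F (UR_inj x ⊗ₜ UR_inj y) = G (UR_inj x ⊗ₜ UR_inj y)) ->
  F =1 G.
Proof.
move=> F11 F1i Fi1 Fii; apply: tens_ext => p q.
apply: (UR_ext (F := F \o tensr q) (G := G \o tensr q)) => [|x] /=.
  exact: (UR_ext (F := F \o tens UR_one) (G := G \o tens UR_one)).
apply: (UR_ext (F := F \o tens (UR_inj x)) (G := G \o tens (UR_inj x)))
  => [|y]; [exact: Fi1 | exact: Fii].
Qed.

Lemma UR_comul1 : UR_comul UR_one = UR_one ⊗ₜ UR_one.
Proof.
by rewrite /UR_comul /= scale1r linear0 tens0l tens0r !addr0.
Qed.

Lemma UR_comuli x :
  UR_comul (UR_inj x) = UR_inj x ⊗ₜ UR_one + UR_one ⊗ₜ UR_inj x.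
Proof. by rewrite /UR_comul /= scale0r add0r. Qed.

Lemma UR_mul1 p : UR_mul (UR_one ⊗ₜ p) = p.
Proof.
case: p => l x; rewrite UR_mulE /UR_mul_form /= linear0l addr0 scale1r.
by rewrite mul1r.
Qed.

Lemma UR_muli1 x : UR_mul (UR_inj x ⊗ₜ UR_one) = 0.
Proof. by rewrite UR_mulE /UR_mul_form /= linear0r scale0r addr0 mul0r. Qed.

Lemma UR_mulii x y :
  UR_mul (UR_inj x ⊗ₜ UR_inj y) = UR_inj (lbracket x y).
Proof. by rewrite UR_mulE /UR_mul_form /= scale0r add0r mul0r. Qed.

Fact UR_comulA p :
  tassoc (tmap UR_comul idfun (UR_comul p)) = tmap idfun UR_comul (UR_comul p).
Proof.
apply: (UR_ext (F := tassoc \o tmap UR_comul idfun \o UR_comul)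
               (G := tmap idfun UR_comul \o UR_comul)) => [|x] /=.
  by rewrite UR_comul1 !tmapE /= UR_comul1 tassocE.
rewrite UR_comuli !linearD /= !tmapE /= !UR_comul1 !UR_comuli.
by rewrite tensDl tensDr !linearD /= !tassocE !addrA.
Qed.

Fact UR_counitl p : tmap UR_counit idfun (UR_comul p) = (1 : K^o) ⊗ₜ p.
Proof.
apply: (UR_ext (F := tmap UR_counit idfun \o UR_comul)
               (G := @tens K K^o UR 1)) => [|x] /=.
  by rewrite UR_comul1 tmapE.
by rewrite UR_comuli linearD /= !tmapE /= tens0l add0r.
Qed.

Fact UR_counitr p : tmap idfun UR_counit (UR_comul p) = p ⊗ₜ (1 : K^o).
Proof.
apply: (UR_ext (F := tmap idfun UR_counit \o UR_comul)
               (G := @tensr K UR K^o 1)) => [|x] /=.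
  by rewrite UR_comul1 tmapE.
by rewrite UR_comuli linearD /= !tmapE /= tens0r addr0.
Qed.

HB.instance Definition _ := isC3Coalgebra.Build K UR
  UR_comulA UR_counitl UR_counitr UR_comul1 (erefl (1 : K^o)).

Lemma comul_UR1 : comul (UR_one : UR) = UR_one ⊗ₜ UR_one.
Proof. exact: UR_comul1. Qed.

Lemma comul_URi x :
  comul (UR_inj x : UR) = UR_inj x ⊗ₜ UR_one + UR_one ⊗ₜ UR_inj x.
Proof. exact: UR_comuli. Qed.

Fact UR_mul_morphism : c3_morphism (UR_mul : {linear UR ⊗ UR -> UR}).
Proof.
split=> [z|z|]; last exact: UR_mul1.
  apply: (UR_ext2 (F := UR_comul \o UR_mul)
                  (G := tmap UR_mul UR_mul \o tens_comul)) => [|y|x|x y].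
  - rewrite /= tens_comulE !comul_UR1 tmidE tmapE /= !UR_mul1.
    exact: UR_comul1.
  - rewrite /= tens_comulE comul_UR1 comul_URi tensDr (linearD tmid) /= !tmidE.
    rewrite (linearD (tmap _ _)) /= !tmapE /= !UR_mul1; exact: UR_comuli.
  - rewrite /= tens_comulE comul_UR1 comul_URi tensDl (linearD tmid) /= !tmidE.
    rewrite (linearD (tmap _ _)) /= !tmapE /= !UR_muli1.
    by rewrite (linear0 UR_comul) tens0l tens0r addr0.
  - rewrite /= tens_comulE !comul_URi tmid_prim !(linearD (tmap _ _)) /= !tmapE.
    rewrite /= !UR_muli1 !UR_mulii !UR_mul1 tens0l tens0r addr0 add0r.
    exact: UR_comuli.
apply: (UR_ext2 (F := UR_counit \o UR_mul) (G := tens_counit)) => [|y|x|x y] /=.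
- by rewrite tens_counitE UR_mul1 /= mulr1.
- by rewrite tens_counitE UR_mul1 /= mulr0.
- by rewrite tens_counitE UR_muli1 /= mul0r.
- by rewrite tens_counitE UR_mulii /= mulr0.
Qed.

Fact UR_mul_one p : UR_mul (p ⊗ₜ coone) = (counit p : K) *: (coone : UR).
Proof.
rewrite [coone](_ : _ = UR_one) // [p in LHS]UR_decomp tensDl linearD tensZl.
by rewrite linearZ_LR /= UR_mul1 UR_muli1 addr0.
Qed.

Fact UR_selfdistr a b c :
  UR_mul (a ⊗ₜ UR_mul (b ⊗ₜ c)) =
  UR_mul (tmap (UR_mul \o tensr b) (UR_mul \o tensr c) (UR_comul a)).
Proof.
apply: (UR_ext (F := UR_mul \o tensr (UR_mul (b ⊗ₜ c)))
  (G := UR_mul \o tmap (UR_mul \o tensr b) (UR_mul \o tensr c) \o UR_comul))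
  => [|x] /=; rewrite /tensr.
  by rewrite UR_comul1 tmapE /= /tensr !UR_mul1.
rewrite UR_comuli !linearD /= !tmapE /= /tensr !UR_mul1.
rewrite !UR_mulE /UR_mul_form -[RHS]/(_, _) /= !scale0r !mul0r !mulr0 !add0r.
congr pair; rewrite linearDr linearZr_LR lbracketP.
by rewrite scale0r add0r addrCA.
Qed.

HB.instance Definition _ := isRackBialgebra.Build K UR
  UR_mul_morphism UR_mul1 UR_mul_one UR_selfdistr.

End UR.

Arguments UR_inj {K h}.
Arguments UR_one {K h}.

Section URHom.
Variables (K : comNzRingType) (g h : leibnizType K) (f : leibniz_hom g h).

Definition UR_fun (p : UR g) : UR h := (p.1, f p.2).

Fact UR_fun_is_linear : linear UR_fun.
Proof. by move=> a p q; rewrite /UR_fun /= linearP. Qed.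
HB.instance Definition _ :=
  GRing.isLinear.Build K (UR g) (UR h) *:%R UR_fun UR_fun_is_linear.

Lemma UR_fun1 : UR_fun UR_one = UR_one.
Proof. by rewrite /UR_fun /= linear0. Qed.

Fact UR_fun_c3 : c3_morphism (UR_fun : {linear UR g -> UR h}).
Proof.
split=> [p|//|]; last exact: UR_fun1.
apply: (UR_ext (F := @UR_comul K h \o UR_fun)
               (G := tmap UR_fun UR_fun \o @UR_comul K g)) => [|x] /=.
  by rewrite UR_fun1 !UR_comul1 tmapE /= UR_fun1.
by rewrite !UR_comuli linearD /= !tmapE /= UR_fun1.
Qed.

Fact UR_funM (p q : UR g) : UR_fun (p ▷ q) = UR_fun p ▷ UR_fun q.
Proof.
rewrite /rack /rack_mul /= !UR_mulE /UR_fun /UR_mul_form /=.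
by rewrite linearD linearZ_LR leibniz_homM.
Qed.

Definition UR_hom : rack_hom (UR g) (UR h) := RackHom UR_fun_c3 UR_funM.

End URHom.

Record category := Category {
  cat_obj :> Type;
  cat_hom : cat_obj -> cat_obj -> Type;
  cat_id : forall a, cat_hom a a;
  cat_comp : forall a b c, cat_hom b c -> cat_hom a b -> cat_hom a c;
  cat_comp1f : forall a b (f : cat_hom a b), cat_comp (cat_id b) f = f;
  cat_compf1 : forall a b (f : cat_hom a b), cat_comp f (cat_id a) = f;
  cat_compA : forall a b c d
      (f : cat_hom c d) (g : cat_hom b c) (h : cat_hom a b),
    cat_comp f (cat_comp g h) = cat_comp (cat_comp f g) h
}.

Arguments cat_hom {c0} a b.
Arguments cat_id {c0} a.
Arguments cat_comp {c0 a b c} f g.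

Record functor (C D : category) := Functor {
  fun_obj :> C -> D;
  fun_hom : forall a b : C, cat_hom a b -> cat_hom (fun_obj a) (fun_obj b);
  fun_id : forall a : C, fun_hom (cat_id a) = cat_id (fun_obj a);
  fun_comp : forall (a b c : C) (f : cat_hom b c) (g : cat_hom a b),
    fun_hom (cat_comp f g) = cat_comp (fun_hom f) (fun_hom g)
}.

Arguments fun_hom {C D} F {a b} f : rename.

Definition left_adjoint (C D : category) (F : functor C D) (G : functor D C) :=
  exists phi : forall (a : C) (b : D), cat_hom (F a) b -> cat_hom a (G b),
    (forall a b, bijective (phi a b)) /\
    (forall (a a' : C) (b b' : D) (u : cat_hom a' a) (v : cat_hom b b')
        (f : cat_hom (F a) b),
      phi a' b' (cat_comp v (cat_comp f (fun_hom F u))) =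
      cat_comp (fun_hom G v) (cat_comp (phi a b f) u)).

Section RackLeibnizCategories.
Variable K : comNzRingType.

Definition rack_bialgebras : category := @Category
  (rackBialgType K) (@rack_hom K) (@rack_id K) (@rack_comp K)
  (fun B C f => rack_hom_eqP (f := rack_comp (rack_id C) f) (g := f)
    (fun _ => erefl))
  (fun B C f => rack_hom_eqP (f := rack_comp f (rack_id B)) (g := f)
    (fun _ => erefl))
  (fun A B C D f g h => rack_hom_eqP (f := rack_comp f (rack_comp g h))
    (g := rack_comp (rack_comp f g) h) (fun _ => erefl)).

Definition leibniz_algebras : category := @Category
  (leibnizType K) (@leibniz_hom K) (@leibniz_id K) (@leibniz_comp K)
  (fun g h f => leibniz_hom_eqP (e := leibniz_comp (leibniz_id h) f) (f := f)
    (fun _ => erefl))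
  (fun g h f => leibniz_hom_eqP (e := leibniz_comp f (leibniz_id g)) (f := f)
    (fun _ => erefl))
  (fun a b c d f g h => leibniz_hom_eqP (e := leibniz_comp f (leibniz_comp g h))
    (f := leibniz_comp (leibniz_comp f g) h) (fun _ => erefl)).

Fact Prim_id (B : rackBialgType K) :
  prim_hom (rack_id B) = leibniz_id (prim B).
Proof. by apply: leibniz_hom_eqP => x; apply: val_inj. Qed.

Fact Prim_comp (A B C : rackBialgType K) (f : rack_hom B C) (g : rack_hom A B) :
  prim_hom (rack_comp f g) = leibniz_comp (prim_hom f) (prim_hom g).
Proof. by apply: leibniz_hom_eqP => x; apply: val_inj. Qed.

Definition Prim_functor : functor rack_bialgebras leibniz_algebras :=
  @Functor rack_bialgebras leibniz_algebras
    (fun B => prim B : leibnizType K) (@prim_hom K) Prim_id Prim_comp.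

Fact UR_id (h : leibnizType K) : UR_hom (leibniz_id h) = rack_id (UR h).
Proof. by apply: rack_hom_eqP => -[]. Qed.

Fact UR_comp (e g h : leibnizType K) (f : leibniz_hom g h)
    (f' : leibniz_hom e g) :
  UR_hom (leibniz_comp f f') = rack_comp (UR_hom f) (UR_hom f').
Proof. by apply: rack_hom_eqP. Qed.

Definition UR_functor : functor leibniz_algebras rack_bialgebras :=
  @Functor leibniz_algebras rack_bialgebras
    (fun h => UR h : rackBialgType K) (@UR_hom K) UR_id UR_comp.

End RackLeibnizCategories.

(* Main.v *)
Require Import Defs.
From HB Require Import structures.
From mathcomp Require Import all_boot all_order all_algebra.
Import GRing.Theory.
Local Open Scope ring_scope.
Local Open Scope rack_scope.

(** The module UR(h) is K 1 + h, so a linear map out of it is determined by the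
    image of 1 and by its restriction to h. A rack bialgebra morphism sends 1 to
    1, so only the restriction to h is free; and the elements of h are primitive
    in UR(h), with bracket the rack product, so this restriction is a Leibniz
    morphism into Prim(C). Conversely, given a Leibniz morphism f from h to
    Prim(C), the only candidate l 1 + x |-> l 1 + f(x) is a morphism: it respects
    the comultiplication because f(x) is primitive, the counit because primitive
    elements have counit zero, and the product because both sides of the
    multiplicativity equation are bilinear and agree on 1 and on h: by the axioms
    1 |> a = a and a |> 1 = epsilon(a) 1, and because f preserves brackets
    (UR_extension). Uniqueness is UR_hom_ext.

    The adjunction is the one attached to the unit prim_unit from h to
    Prim(UR(h)), the inclusion of h: it sends g : UR(h) -> C to the composite of Prim(g) with the
    unit. The universal property says that this map is bijective
    (prim_transpose_bij), and naturality is functoriality of Prim together with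
    naturality of the inclusion. *)

Section Extension.
Context {K : comNzRingType} {h : leibnizType K} {C : rackBialgType K}.

Section Construction.
Variable f : leibniz_hom h (prim C).

Definition UR_extension_fun (p : UR h) : C :=
  (p.1 : K) *: coone + prim_val (f p.2).

Fact UR_extension_is_linear : linear UR_extension_fun.
Proof.
move=> a p q; rewrite /UR_extension_fun /= scalerDl -scalerA linearP /=.
by rewrite scalerDr addrACA.
Qed.
HB.instance Definition _ := GRing.isLinear.Build K (UR h) C *:%R
  UR_extension_fun UR_extension_is_linear.

Lemma UR_extension1 : UR_extension_fun UR_one = coone.
Proof. by rewrite /UR_extension_fun /= linear0 scale1r addr0. Qed.

Lemma UR_extension_inj x : UR_extension_fun (UR_inj x) = prim_val (f x).
Proof. by rewrite /UR_extension_fun /= scale0r add0r. Qed.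

Fact UR_extension_c3 : c3_morphism (UR_extension_fun : {linear UR h -> C}).
Proof.
split=> [p|p|]; last exact: UR_extension1.
  apply: (UR_ext (F := comul \o UR_extension_fun)
    (G := tmap UR_extension_fun UR_extension_fun \o @UR_comul K h)) => [|x] /=.
    by rewrite UR_extension1 UR_comul1 tmapE /= UR_extension1 comul_coone.
  rewrite UR_extension_inj UR_comuli (linearD (tmap _ _)) /= !tmapE /=.
  rewrite UR_extension1 UR_extension_inj.
  exact: prim_comul.
apply: (UR_ext (F := counit \o UR_extension_fun) (G := @UR_counit K h))
  => [|x] /=.
  by rewrite UR_extension1 counit_coone.
by rewrite UR_extension_inj; exact: prim_counit.
Qed.

(** Both sides are linear in p (x) q, which leaves the four pairs formed from 1
    and h. The delicate one is x |> 1 with x in h: it is 0 in UR(h), and its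
    image f(x) |> 1 = epsilon(f(x)) 1 vanishes because f(x) is primitive. *)
Fact UR_extensionM (p q : UR h) :
  UR_extension_fun (p ▷ q) = UR_extension_fun p ▷ UR_extension_fun q.
Proof.
suff /(_ (p ⊗ₜ q)) : UR_extension_fun \o @UR_mul K h =1
    rack_mul \o tmap UR_extension_fun UR_extension_fun by rewrite /= tmapE.
apply: UR_ext2 => [|y|x|x y]; rewrite /= tmapE /=.
- by rewrite UR_mul1 UR_extension1 coone_rack.
- by rewrite UR_mul1 UR_extension1 coone_rack.
- rewrite UR_muli1 linear0 UR_extension1 UR_extension_inj rack_coone.
  by rewrite (prim_counit (f x)) scale0r.
- by rewrite UR_mulii !UR_extension_inj leibniz_homM.
Qed.

Definition UR_extension : rack_hom (UR h) C :=
  RackHom UR_extension_c3 UR_extensionM.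

End Construction.

(** Preservation of 1 is part of being a morphism, which leaves only the values
    on h. *)
Lemma UR_hom_ext (g g' : rack_hom (UR h) C) :
  (forall x : h, g (UR_inj x) = g' (UR_inj x)) -> g = g'.
Proof.
move=> gg'; apply: rack_hom_eqP; apply: UR_ext => //.
by rewrite (c3m_coone (rack_hom_c3 g)) (c3m_coone (rack_hom_c3 g')).
Qed.

End Extension.

Section Unit.
Context {K : comNzRingType}.

Section Construction.
Variable h : leibnizType K.

Fact UR_inj_prim (x : h) : UR_inj x \in @prim_pred K (UR h).
Proof. by apply/eqP; rewrite comul_URi. Qed.

Definition prim_unit_fun (x : h) : prim (UR h) := Prim (UR_inj_prim x).

Fact prim_unit_is_linear : linear prim_unit_fun.
Proof. by move=> a x y; apply: val_inj; rewrite /= linearP. Qed.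
HB.instance Definition _ := GRing.isLinear.Build K h (prim (UR h)) *:%R
  prim_unit_fun prim_unit_is_linear.

Fact prim_unitM (x y : h) :
  prim_unit_fun (lbracket x y) = lbracket (prim_unit_fun x) (prim_unit_fun y).
Proof. by apply: val_inj; rewrite /= -UR_mulii. Qed.

Definition prim_unit : leibniz_hom h (prim (UR h)) := LeibnizHom prim_unitM.

End Construction.

Definition prim_transpose (h : leibnizType K) (C : rackBialgType K)
    (g : rack_hom (UR h) C) : leibniz_hom h (prim C) :=
  leibniz_comp (prim_hom g) (prim_unit h).

Lemma prim_transpose_bij (h : leibnizType K) (C : rackBialgType K) :
  bijective (@prim_transpose h C).
Proof.
exists UR_extension => [g|f].
  by apply: UR_hom_ext => x; rewrite /= UR_extension_inj.
by apply: leibniz_hom_eqP => x; apply: val_inj; rewrite /= UR_extension_inj.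
Qed.

(** Both composites send x to v(g(u(x))): Prim only restricts morphisms, and
    UR(u) extends u. *)
Lemma prim_transpose_natural (h h' : leibnizType K) (C C' : rackBialgType K)
    (u : leibniz_hom h' h) (v : rack_hom C C') (g : rack_hom (UR h) C) :
  prim_transpose h' C' (rack_comp v (rack_comp g (UR_hom u))) =
  leibniz_comp (prim_hom v) (leibniz_comp (prim_transpose h C g) u).
Proof. by apply: leibniz_hom_eqP => x; apply: val_inj. Qed.

End Unit.

Theorem theorem2p3 (K : comNzRingType) (iota : {rmorphism rat -> K}) :
  left_adjoint (UR_functor K) (Prim_functor K) /\
  (forall (h : leibnizType K) (C : rackBialgType K)
      (f : leibniz_hom h (prim C)),
    exists! fhat : rack_hom (UR h) C,
      forall x : h, fhat (UR_inj x) = prim_val (f x)).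
Proof.
split.
  exists (@prim_transpose K); split; first exact: prim_transpose_bij.
  exact: prim_transpose_natural.
move=> h C f; exists (UR_extension f); split=> [x|g gf].
  exact: UR_extension_inj.
by apply: UR_hom_ext => x; rewrite gf; exact: UR_extension_inj.
Qed.
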